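(* Let $\psi:M^m\to\bar M^{n+1}$ be a mean curvature flow soliton in the warped product $\bar M=I\times_hP$ with respect to the conformal vector field $X=h(t)\partial_t$, with constant $c\neq0$. Then, on $M$, $$\Delta\eta=m\varphi+\frac1c|\mathbf H|^2=m\,h'(\pi\circ\psi)+\frac1c|\mathbf H|^2$$ and $$\Delta_{-c\eta}\eta=m\varphi+c|X|^2=m\,h'(\pi\circ\psi)+c\,h^2(\pi\circ\psi).$$
   Context: $I\subset\mathbb R$ is an open interval, $h:I\to(0,\infty)$ is smooth, $(P^n,g_0)$ is a Riemannian manifold, and $\bar M^{n+1}=I\times_hP$ is $I\times P$ with metric $dt^2+h(t)^2g_0$; $\pi(t,p)=t$. The field $X=h(t)\partial_t$ is closed and conformal: $\bar\nabla_UX=h'(t)U$. An isometric immersion $\psi:M^m\to\bar M^{n+1}$ is a mean curvature flow soliton with respect to $X$ if $c\,X^\perp=\mathbf H$ along $\psi$ for some constant $c\in\mathbb R$, where $\perp$ is projection on the normal bundle and $\mathbf H$ is the non-normalized mean curvature vector (the trace of the second fundamental form). Fix $t_0\in I$ and put $\eta(x)=\int_{t_0}^{\pi(\psi(x))}h(s)\,ds$ for $x\in M$. Put $\varphi=\frac1{n+1}(\operatorname{div}_{\bar M}X)\circ\psi=h'(\pi\circ\psi)$. For $f\in C^1(M)$, $\Delta_fu=\Delta u-\langle\nabla f,\nabla u\rangle$; thus $\Delta_{-c\eta}u=\Delta u+c\langle\nabla\eta,\nabla u\rangle$. *)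

(* Defs.v *)
From HB Require Import structures.
From mathcomp Require Import all_boot all_order all_algebra.
From mathcomp Require Import all_classical all_reals all_analysis.

Set Implicit Arguments.
Unset Strict Implicit.
Unset Printing Implicit Defensive.

Import Order.TTheory GRing.Theory Num.Theory.
Import numFieldNormedType.Exports.

Local Open Scope classical_set_scope.
Local Open Scope ring_scope.

Definition evec (R : realType) (n : nat) (i : 'I_n) : 'rV[R]_n := delta_mx 0 i.

Definition partial (R : realType) (n : nat) (W : normedModType R) (i : 'I_n)
    (f : 'rV[R]_n -> W) : 'rV[R]_n -> W :=
  fun y => 'D_(evec R i) f y.

Fixpoint Ck (R : realType) (n : nat) (W : normedModType R) (k : nat)
    (U : set 'rV[R]_n) (f : 'rV[R]_n -> W) : Prop :=
  match k with
  | 0 => forall y, U y -> {for y, continuous f}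
  | k'.+1 => forall i : 'I_n,
      (forall y, U y -> derivable f y (evec R i)) /\ Ck k' U (partial i f)
  end.

(* Only used for open [U]. *)
Definition smooth_on (R : realType) (n : nat) (W : normedModType R)
    (U : set 'rV[R]_n) (f : 'rV[R]_n -> W) : Prop :=
  forall k, Ck k U f.

Definition smooth1_on (R : realType) (I : set R) (h : R -> R) : Prop :=
  forall k t, I t -> derivable (derive1n k h) t 1.

(* A chart of a space [T], together with the matrix of the Riemannian metric in
   the coordinates of that chart. [chart_coord] is relevant only on [chart_dom];
   [chart_param] and [chart_metric] only on [chart_coord @` chart_dom]. *)
Record rchart (R : realType) (n : nat) (T : Type) := RChart {
  chart_dom : set T ;
  chart_coord : T -> 'rV[R]_n ;
  chart_param : 'rV[R]_n -> T ;
  chart_metric : 'rV[R]_n -> 'M[R]_n }.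

Definition inner (R : realType) (n : nat) (g : 'M[R]_n) (v w : 'rV[R]_n) : R :=
  (v *m g *m w^T) 0 0.

(* ['J f y] acts on row vectors from the right, so its [i]-th row is the
   [i]-th partial derivative of [f]. *)
Definition pullback (R : realType) (m n : nat) (f : 'rV[R]_m -> 'rV[R]_n)
    (G : 'rV[R]_n -> 'M[R]_n) (y : 'rV[R]_m) : 'M[R]_m :=
  'J f y *m G (f y) *m ('J f y)^T.

Definition is_rchart (R : realType) (n : nat) (T : topologicalType)
    (a : rchart R n T) : Prop :=
  let U := chart_coord a @` chart_dom a in
  [/\ [/\ open (chart_dom a), open U
      & forall x, chart_dom a x -> chart_param a (chart_coord a x) = x],
      (forall x, chart_dom a x -> {for x, continuous (chart_coord a)}) /\
      (forall y, U y -> {for y, continuous (chart_param a)}),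
      smooth_on U (chart_metric a),
      forall y, U y -> (chart_metric a y)^T = chart_metric a y
    & forall y v, U y -> v != 0 -> 0 < inner (chart_metric a y) v v].

Definition compatible (R : realType) (n : nat) (T : Type)
    (a b : rchart R n T) : Prop :=
  let V := chart_coord a @` (chart_dom a `&` chart_dom b) in
  let tau := chart_coord b \o chart_param a in
  smooth_on V tau /\
  forall y, V y -> chart_metric a y = pullback tau (chart_metric b) y.

(* The open subset [D] of [T] is a Riemannian manifold of dimension [n], with
   smooth atlas and metric given by [A]. *)
Definition riemannian (R : realType) (n : nat) (T : topologicalType)
    (D : set T) (A : set (rchart R n T)) : Prop :=
  [/\ hausdorff_space T /\ @second_countable T,
      (forall a, A a -> is_rchart a),
      D = \bigcup_(a in A) chart_dom a
    & forall a b, A a -> A b -> compatible a b].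

(* From here on, [G] is the matrix of the metric in some coordinates [y]. *)

Definition christoffel (R : realType) (n : nat) (G : 'rV[R]_n -> 'M[R]_n)
    (y : 'rV[R]_n) (k i j : 'I_n) : R :=
  2^-1 * \sum_l invmx (G y) k l *
    (partial i (fun z => G z j l) y + partial j (fun z => G z i l) y
     - partial l (fun z => G z i j) y).

Definition gradient (R : realType) (n : nat) (G : 'rV[R]_n -> 'M[R]_n)
    (u : 'rV[R]_n -> R) (y : 'rV[R]_n) : 'rV[R]_n :=
  (\row_j partial j u y) *m invmx (G y).

(* The trace of the endomorphism [U |-> nabla_U X]. *)
Definition divergence (R : realType) (n : nat) (G : 'rV[R]_n -> 'M[R]_n)
    (X : 'rV[R]_n -> 'rV[R]_n) (y : 'rV[R]_n) : R :=
  \sum_i (partial i X y 0 i + \sum_j christoffel G y i i j * X y 0 j).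

Definition laplacian (R : realType) (n : nat) (G : 'rV[R]_n -> 'M[R]_n)
    (u : 'rV[R]_n -> R) (y : 'rV[R]_n) : R :=
  divergence G (gradient G u) y.

Definition weighted_laplacian (R : realType) (n : nat) (G : 'rV[R]_n -> 'M[R]_n)
    (f u : 'rV[R]_n -> R) (y : 'rV[R]_n) : R :=
  laplacian G u y - inner (G y) (gradient G f y) (gradient G u y).

(* [F] is the immersion read in coordinates of the source (metric [G]) and of
   the target (metric [Gbar]). *)

(* The covariant derivative, in the target and along [F], of the field
   [dF(e_j)] in the direction [dF(e_i)]. *)
Definition cov_deriv (R : realType) (m n : nat) (Gbar : 'rV[R]_n -> 'M[R]_n)
    (F : 'rV[R]_m -> 'rV[R]_n) (y : 'rV[R]_m) (i j : 'I_m) : 'rV[R]_n :=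
  partial i (partial j F) y
  + \row_k \sum_p \sum_q
      christoffel Gbar (F y) k p q * partial i F y 0 p * partial j F y 0 q.

Definition tangent_part (R : realType) (m n : nat) (G : 'rV[R]_m -> 'M[R]_m)
    (Gbar : 'rV[R]_n -> 'M[R]_n) (F : 'rV[R]_m -> 'rV[R]_n) (y : 'rV[R]_m)
    (v : 'rV[R]_n) : 'rV[R]_n :=
  \sum_i \sum_j
    (invmx (G y) i j * inner (Gbar (F y)) v (partial j F y)) *: partial i F y.

Definition normal_part (R : realType) (m n : nat) (G : 'rV[R]_m -> 'M[R]_m)
    (Gbar : 'rV[R]_n -> 'M[R]_n) (F : 'rV[R]_m -> 'rV[R]_n) (y : 'rV[R]_m)
    (v : 'rV[R]_n) : 'rV[R]_n :=
  v - tangent_part G Gbar F y v.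

Definition second_form (R : realType) (m n : nat) (G : 'rV[R]_m -> 'M[R]_m)
    (Gbar : 'rV[R]_n -> 'M[R]_n) (F : 'rV[R]_m -> 'rV[R]_n) (y : 'rV[R]_m)
    (i j : 'I_m) : 'rV[R]_n :=
  normal_part G Gbar F y (cov_deriv Gbar F y i j).

Definition mean_curvature (R : realType) (m n : nat) (G : 'rV[R]_m -> 'M[R]_m)
    (Gbar : 'rV[R]_n -> 'M[R]_n) (F : 'rV[R]_m -> 'rV[R]_n) (y : 'rV[R]_m)
    : 'rV[R]_n :=
  \sum_i \sum_j invmx (G y) i j *: second_form G Gbar F y i j.

Definition local_rep (R : realType) (m n : nat) (S T : Type)
    (a : rchart R m S) (b : rchart R n T) (psi : S -> T)
    : 'rV[R]_m -> 'rV[R]_n :=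
  chart_coord b \o psi \o chart_param a.

Definition isometric_immersion (R : realType) (m n : nat)
    (S T : topologicalType) (A : set (rchart R m S)) (B : set (rchart R n T))
    (psi : S -> T) : Prop :=
  continuous psi /\
  forall a b, A a -> B b ->
    let V := chart_coord a @` (chart_dom a `&` psi @^-1` chart_dom b) in
    let F := local_rep a b psi in
    [/\ smooth_on V F,
        forall y, V y -> row_free ('J F y)
      & forall y, V y -> chart_metric a y = pullback F (chart_metric b) y].

(* The field [X] on the target is given by its components in each chart. *)
Definition mcf_soliton (R : realType) (m n : nat)
    (S T : topologicalType) (A : set (rchart R m S)) (B : set (rchart R n T))
    (X : rchart R n T -> 'rV[R]_n -> 'rV[R]_n) (c : R) (psi : S -> T) : Prop :=
  isometric_immersion A B psi /\
  forall x a b, A a -> B b -> chart_dom a x -> chart_dom b (psi x) ->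
    let F := local_rep a b psi in
    let y := chart_coord a x in
    c *: normal_part (chart_metric a) (chart_metric b) F y (X b (F y)) =
    mean_curvature (chart_metric a) (chart_metric b) F y.

(* The product of the coordinate [t] on [I] and a chart of [P], with the metric
   [dt^2 + h(t)^2 g_0]. *)
Definition warped_chart (R : realType) (n : nat) (P : Type)
    (I : set R) (h : R -> R) (a : rchart R n P) : rchart R (1 + n) (R * P) :=
  RChart
    (I `*` chart_dom a)
    (fun z => row_mx z.1%:M (chart_coord a z.2))
    (fun y => (lsubmx y 0 0, chart_param a (rsubmx y)))
    (fun y => block_mx 1%:M 0
                0 (h (lsubmx y 0 0) ^+ 2 *: chart_metric a (rsubmx y))).

Definition warped_atlas (R : realType) (n : nat) (P : Type)
    (I : set R) (h : R -> R) (A : set (rchart R n P))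
    : set (rchart R (1 + n) (R * P)) :=
  warped_chart I h @` A.

(* [h(t) d/dt]: its components are the same in all charts of [warped_atlas]. *)
Definition conformal_field (R : realType) (n : nat) (h : R -> R)
    (y : 'rV[R]_(1 + n)) : 'rV[R]_(1 + n) :=
  row_mx (h (lsubmx y 0 0))%:M 0.

(* The integral of [f] from [a] to [b], with its usual sign when [b < a]. *)
Definition oriented_integral (R : realType) (f : R -> R) (a b : R) : R :=
  if a <= b then \int[lebesgue_measure]_(s in `[a, b]) f s
  else - \int[lebesgue_measure]_(s in `[b, a]) f s.

(* Main.v *)
Require Import Defs.
From HB Require Import structures.
From mathcomp Require Import all_boot all_order all_algebra perm.
From mathcomp Require Import all_classical all_reals all_analysis.
From mathcomp Require Import ring lra.

(* Write G = J Gbar J^T for the induced metric, the rows of J being the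
   derivatives F_j of the immersion, and D_ij for the covariant derivative along
   F of F_j in the direction F_i.  Metric compatibility along F and the symmetry
   of D give the Gauss formula: the tangential part of D_ij is Gamma^k_ij F_k.
   Since u_j = <X, F_j> and X is closed conformal, u_ij = h' G_ij + <X, D_ij>, so
   taking the trace of the Hessian, Delta u = m h' + <X, H>.  As H = c X^perp,
   <X, H> = |H|^2 / c, and |grad u|^2 = |X^T|^2 gives the weighted identity. *)

Set Implicit Arguments.
Unset Strict Implicit.
Unset Printing Implicit Defensive.

Import Order.TTheory GRing.Theory Num.Theory.
Import numFieldNormedType.Exports.

Local Open Scope classical_set_scope.
Local Open Scope ring_scope.

(** * Functions of several real variables *)

Section DifferentialCalculus.
Context {R : realType}.

(** Smoothness is given as [Ck]: iterated derivatives along the coordinate axes exist and are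
    continuous. The chain rule for [Gbar] and [X] along the immersion needs true differentiability,
    and the symmetry of D needs commuting second partials; both are drawn from [Ck] by mean value
    arguments. Covariant differentiation along F acts on matrices whose rows are vector fields: the
    connection becomes a matrix multiplied from the right, and one product rule serves both G = J
    Gbar J^T and du = X Gbar J^T. The Laplacian is by definition the divergence of a gradient, so
    its agreement with the trace of the Hessian is a computation of its own. That u_j = <X, F_j> is
    the fundamental theorem of calculus for eta, and that X is closed conformal is read off the
    block form of the warped metric. *)

Lemma is_derive_line (V W : normedModType R) (f : V -> W) (p v : V) (s : R) df :
  is_derive (p + s *: v) v f df -> is_derive s 1 (fun t => f (p + t *: v)) df.
Proof.
case=> fd fE; have E : (fun h : R => h^-1 *: ((f \o shift (p + s *: v)) (h *: v)
    - f (p + s *: v))) = (fun h : R => h^-1 *: (((fun t => f (p + t *: v)) \o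
    shift s) (h *: 1) - f (p + s *: v))).
  apply/funext => h /=; congr (_ *: (f _ - _)).
  by rewrite [h *: 1]mulr1 scalerDl addrC addrA addrAC -addrA.
split; first by move: fd; rewrite /derivable E.
by rewrite -fE /derive E.
Qed.

Lemma is_derive_translate (V W : normedModType R) (f : V -> W) (a p v : V) df :
  is_derive (p + a) v f df -> is_derive p v (fun z => f (z + a)) df.
Proof.
case=> fd fE; have E : (fun h : R => h^-1 *: ((f \o shift (p + a)) (h *: v)
    - f (p + a))) = (fun h : R => h^-1 *: (((fun z => f (z + a)) \o
    shift p) (h *: v) - f (p + a))).
  by apply/funext => h /=; rewrite addrA.
split; first by move: fd; rewrite /derivable E.
by rewrite -fE /derive E.
Qed.

(** The increment [s] may have either sign, so the intermediate point is located only by its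
    absolute value; for [s < 0] the mean value theorem runs on [[s, 0]]. *)
Lemma line_MVT (V : normedModType R) (f df : V -> R) (p v : V) (s : R) :
  (forall t, `|t| <= `|s| -> is_derive (p + t *: v) v f (df (p + t *: v))) ->
  exists2 t, `|t| <= `|s| & f (p + s *: v) - f p = s * df (p + t *: v).
Proof.
move=> fd; pose g t := f (p + t *: v).
have gd (t : R) : `|t| <= `|s| -> is_derive t (1:R) g (df (p + t *: v)).
  by move=> ts; exact/is_derive_line/fd.
have gc a b : (forall t, t \in `[a, b] -> `|t| <= `|s|) ->
    {within `[a, b], continuous g}.
  move=> ab; apply: (@derivable_within_continuous _ _ g `[a, b]) => t tab.
  by have [] := gd _ (ab _ tab).
have [s0|s0] := leP 0 s.
  have E t : t \in `[0, s] -> `|t| <= `|s|.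
    by rewrite in_itv/= => /andP[t0 ts]; rewrite !ger0_norm.
  have [x|t /E ts] := @MVT_segment R g (fun t => df (p + t *: v)) 0 s s0 _ (gc _ _ E).
    by rewrite in_itv/= => /andP[? ?]; apply/gd/E; rewrite in_itv/= !ltW.
  by rewrite /g scale0r addr0 subr0 mulrC; exists t.
have E t : t \in `[s, 0] -> `|t| <= `|s|.
  by rewrite in_itv/= => /andP[t0 ts]; rewrite !ler0_norm ?lerN2// ltW.
have [x|t /E ts] := @MVT_segment R g (fun t => df (p + t *: v)) s 0 (ltW s0) _ (gc _ _ E).
  by rewrite in_itv/= => /andP[? ?]; apply/gd/E; rewrite in_itv/= !ltW.
rewrite /g scale0r addr0 sub0r mulrN mulrC => h; exists t => //.
by rewrite -opprB h opprK.
Qed.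

(** Two uses of the mean value theorem: along [v] for the increment of [f] in the direction
    [s *: w], then along [w] for [fv]. *)
Lemma second_difference (V : normedModType R) (f fv fvw : V -> R) (y v w : V)
    (s : R) :
  (forall a b, `|a| <= `|s| -> `|b| <= `|s| ->
    is_derive (y + a *: v + b *: w) v f (fv (y + a *: v + b *: w)) /\
    is_derive (y + a *: v + b *: w) w fv (fvw (y + a *: v + b *: w))) ->
  exists a b, [/\ `|a| <= `|s|, `|b| <= `|s| &
    f (y + s *: v + s *: w) - f (y + s *: v) - (f (y + s *: w) - f y) =
    s * (s * fvw (y + a *: v + b *: w))].
Proof.
move=> fd.
have [t ts|a aS] := @line_MVT V (fun z => f (z + s *: w) - f z)
  (fun z => fv (z + s *: w) - fv z) y v s.
  apply: is_deriveB.
    by apply: is_derive_translate; apply: (fd _ _ ts _).1.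
  have := (fd t 0 ts _).1; rewrite scale0r addr0; apply.
  by rewrite normr0.
move=> ->.
have [t ts|b bS ->] := @line_MVT V fv fvw (y + a *: v) w s.
  exact: (fd _ _ aS ts).2.
by exists a, b.
Qed.

(** Schwarz's theorem. The second difference is symmetric in [v] and [w], so the two mixed
    derivatives agree at two points near [y], possibly distinct; continuity at [y] carries the
    equality over. *)
Theorem derive_comm (V : normedModType R) (f fv fw fvw fwv : V -> R)
    (U : set V) (y v w : V) : open U -> U y ->
  (forall z, U z -> is_derive z v f (fv z)) ->
  (forall z, U z -> is_derive z w f (fw z)) ->
  (forall z, U z -> is_derive z w fv (fvw z)) ->
  (forall z, U z -> is_derive z v fw (fwv z)) ->
  {for y, continuous fvw} -> {for y, continuous fwv} -> fvw y = fwv y.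
Proof.
move=> oU Uy dfv dfw dfvw dfwv cvw cwv.
apply/eqP; rewrite -subr_eq0 -normr_le0; apply/ler_addgt0Pr => e e0.
rewrite add0r.
have e20 : 0 < e / 2 by rewrite divr_gt0.
have : \forall z \near y, [/\ U z, `|fvw y - fvw z| < e / 2
    & `|fwv y - fwv z| < e / 2].
  near=> z; split.
  - by near: z; exact: open_nbhs_nbhs.
  - by near: z; move/cvgrPdist_lt : cvw; apply.
  - by near: z; move/cvgrPdist_lt : cwv; apply.
move=> /nbhs_ballP[d /= d0 dP].
(* The step keeps the whole parallelogram spanned by [s *: v] and [s *: w] in the ball of radius
   [d]; the [+ 1] keeps the denominator positive when both vectors vanish. *)
pose s := d / (2 * (`|v| + `|w| + 1)).
have D0 : 0 < `|v| + `|w| + 1 by rewrite ltr_wpDl// addr_ge0.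
have s0 : 0 < s by rewrite divr_gt0// mulr_gt0.
have sd : s * (`|v| + `|w|) < d.
  rewrite /s mulrAC ltr_pdivrMr ?mulr_gt0// ltr_pM2l//.
  by have := normr_ge0 v; have := normr_ge0 w; lra.
move: s s0 sd => s s0 sd.
have near_ball a b a' b' : `|a| <= `|s| -> `|b| <= `|s| ->
    (a' = v /\ b' = w) \/ (a' = w /\ b' = v) -> ball y d (y + a *: a' + b *: b').
  move=> aS bS ab; rewrite -ball_normE /= opprD addrA opprD addrA subrr sub0r.
  rewrite -opprD normrN.
  apply: (@le_lt_trans _ _ (`|s| * (`|v| + `|w|))); last by rewrite gtr0_norm.
  rewrite (le_trans (ler_normD _ _))// !normrZ mulrDr.
  case: ab => -[-> ->]; last rewrite (addrC (`|s| * `|v|)).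
    by apply: lerD; exact: ler_wpM2r.
  by apply: lerD; exact: ler_wpM2r.
have [|a [b [aS bS E1]]] := @second_difference V f fv fvw y v w s.
  move=> a b aS bS;
    have [] := dP _ (near_ball a b v w aS bS (or_introl _ (conj erefl erefl))).
  by move=> Uz _ _; split; [exact: dfv|exact: dfvw].
have [|a' [b' [a'S b'S E2]]] := @second_difference V f fw fwv y w v s.
  move=> a' b' aS' bS';
    have [] := dP _ (near_ball a' b' w v aS' bS' (or_intror _ (conj erefl erefl))).
  by move=> Uz _ _; split; [exact: dfw|exact: dfwv].
have [_ h1 _] := dP _ (near_ball a b v w aS bS (or_introl _ (conj erefl erefl))).
have [_ _ h2] := dP _ (near_ball a' b' w v a'S b'S (or_intror _ (conj erefl erefl))).
have E : fvw (y + a *: v + b *: w) = fwv (y + a' *: w + b' *: v).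
  have sn0 : s != 0 by rewrite gt_eqF.
  apply: (mulfI sn0); apply: (mulfI sn0); rewrite -E1 -E2.
  by rewrite (addrAC y (s *: w)); ring.
rewrite E in h1.
rewrite -(subrKA (fwv (y + a' *: w + b' *: v))).
rewrite (le_trans (ler_normD _ _))// [leRHS](splitr e) lerD// ltW//.
by rewrite distrC.
Unshelve. all: by end_near. Qed.

(* Truncating the increment coordinatewise moves [y] to [y + v] along the axes, so
   the mean value theorem applies to each step. *)
Lemma differentiable_C1 n (f : 'rV[R]_n -> R) (df : 'I_n -> 'rV[R]_n -> R)
    (U : set 'rV[R]_n) (y : 'rV[R]_n) : open U -> U y ->
  (forall i z, U z -> is_derive z (evec R i) f (df i z)) ->
  (forall i, {for y, continuous (df i)}) -> differentiable f y.
Proof.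
move=> oU Uy fd dfc.
pose L (v : 'rV[R]_n) : R := \sum_i v 0 i * df i y.
have Llin : linear L.
  move=> a u v; rewrite /L scaler_sumr -big_split/=; apply: eq_bigr => i _.
  by rewrite !mxE mulrDl -mulrA.
pose LM := GRing.isLinear.Build _ _ _ _ _ Llin.
pose Ll : {linear 'rV[R]_n -> R} := HB.pack L LM.
have Lc : continuous Ll.
  have -> : (Ll : 'rV[R]_n -> R) = \sum_i (fun v : 'rV[R]_n => v 0 i * df i y).
    by apply/funext => v; rewrite fct_sumE.
  move=> v; apply/differentiable_continuous/differentiable_sum => i.
  apply: differentiableM; last exact: differentiable_cst.
  exact: differentiable_coord.
have Lo (e : {posnum R}) :
    \forall v \near (0 : 'rV[R]_n), `|f (v + y) - (f y + Ll v)| <= e%:num * `|v|.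
  (* Each of the [n] axis steps may cost [e' * |v|]; dividing by [n.+1] also covers [n = 0]. *)
  pose e' := e%:num / n.+1%:R.
  have e'0 : 0 < e' by rewrite divr_gt0.
  have : \forall z \near y, U z /\ forall i, `|df i y - df i z| < e'.
    near=> z; split; first by near: z; exact: open_nbhs_nbhs.
    near: z; apply: filter_forall => i.
    by have /cvgrPdist_lt := dfc i; apply.
  move=> /nbhs_ballP[d /= d0 dP].
  apply/nbhs_ballP; exists d => //= v; rewrite -ball_normE/= sub0r normrN => vd.
  pose tr k : 'rV[R]_n := \row_i (if (i < k)%N then v 0 i else 0).
  have coordle i : `|v 0 i| <= `|v|.
    rewrite [leRHS]/Num.Def.normr/= mx_normrE.
    exact: (le_bigmax _ (fun ij => `|v ij.1 ij.2|) (0, i)).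
  have step (k : 'I_n) : `|f (y + tr k.+1) - f (y + tr k) - v 0 k * df k y|
      <= e' * `|v|.
    have tball t : `|t| <= `|v 0 k| -> ball y d (y + tr k + t *: evec R k).
      move=> tv; rewrite -ball_normE/= -addrA opprD addrA subrr sub0r normrN.
      apply: le_lt_trans vd; rewrite [leLHS]/Num.Def.normr/= mx_normrE.
      apply: bigmax_le => // -[i j] _; rewrite ord1 {i}/= !mxE eqxx/=.
      have [->|jk] := eqVneq j k.
        by rewrite ltnn add0r mulr1 (le_trans tv).
      by rewrite mulr0 addr0; case: ifP => // _; rewrite normr0.
    have [t tv|t tv] := @line_MVT _ f (df k) (y + tr k) (evec R k) (v 0 k).
      by apply: fd; have [] := dP _ (tball _ tv).
    have -> : y + tr k + v 0 k *: evec R k = y + tr k.+1.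
      rewrite -addrA; congr (_ + _); apply/rowP => j; rewrite !mxE eqxx/= ltnS.
      have [->|jk] := eqVneq j k; first by rewrite ltnn leqnn mulr1 add0r.
      by rewrite mulr0 addr0 (leq_eqVlt j k) (negbTE (jk : j != k :> nat)).
    move=> ->; rewrite -mulrBr normrM mulrC ler_pM// distrC ltW//.
    by have [_] := dP _ (tball _ tv); exact.
  have -> : f (v + y) - (f y + Ll v) =
      \sum_(k < n) (f (y + tr k.+1) - f (y + tr k) - v 0 k * df k y).
    rewrite [RHS]sumrB.
    rewrite -(big_mkord xpredT (fun k => f (y + tr k.+1) - f (y + tr k))).
    rewrite telescope_sumr//.
    have -> : tr 0%N = 0 by apply/rowP => j; rewrite !mxE.
    have -> : tr n = v by apply/rowP => j; rewrite !mxE ltn_ord.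
    by rewrite addr0 opprD addrA (addrC v).
  rewrite (le_trans (ler_norm_sum _ _ _))//.
  apply: (@le_trans _ _ (\sum_(k < n) e' * `|v|)).
    by apply: ler_sum => k _; exact: step.
  rewrite sumr_const card_ord -mulr_natr mulrAC ler_wpM2r// /e'.
  by rewrite mulrAC ler_pdivrMr// ler_pM2l// ler_nat.
have dE : 'd f y = Ll :> (_ -> _).
  by apply: diff_unique => //; apply/eqaddoP => _/posnumP[e]; exact: Lo.
apply/diff_locallyP; rewrite dE; split => //.
by apply/eqaddoP => _/posnumP[e]; exact: Lo.
Unshelve. all: by end_near. Qed.

End DifferentialCalculus.

(** * Matrix-valued maps, the chain rule and smooth maps *)

Section MatrixCalculus.
Context {R : realType}.

Lemma is_derive_mul (V : normedModType R) (f g : V -> R) (y v : V) df dg :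
  is_derive y v f df -> is_derive y v g dg ->
  is_derive y v (fun z => f z * g z) (df * g y + f y * dg).
Proof.
move=> fd gd; apply: is_derive_eq; rewrite addrC; congr (_ + _).
exact: mulrC.
Qed.

Lemma is_derive_bigsum (V W : normedModType R) (J : Type) (r : seq J)
    (P : pred J) (f : J -> V -> W) (df : J -> W) (y v : V) :
  (forall i, P i -> is_derive y v (f i) (df i)) ->
  is_derive y v (fun z => \sum_(i <- r | P i) f i z) (\sum_(i <- r | P i) df i).
Proof.
move=> fd; rewrite -[X in is_derive _ _ X]fct_sumE.
elim/big_ind2 : _; [exact: is_derive_cst|move=> *; exact: is_deriveD|exact: fd].
Qed.

Lemma derivable_bigprod (V : normedModType R) (J : Type) (r : seq J)
    (P : pred J) (f : J -> V -> R) (y v : V) :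
  (forall i, P i -> derivable (f i) y v) ->
  derivable (fun z => \prod_(i <- r | P i) f i z) y v.
Proof.
move=> fd; elim: r => [|i r IH].
  by under eq_fun do rewrite big_nil; exact: derivable_cst.
under eq_fun do rewrite big_cons.
case: ifP => [Pi|_]; last exact: IH.
by apply: derivableM; [exact: fd|exact: IH].
Qed.

Lemma is_derive_mxP (V : normedModType R) p q (M : V -> 'M[R]_(p, q)) dM (y v : V) :
  is_derive y v M dM <->
  forall i j, is_derive y v (fun z => M z i j) (dM i j).
Proof.
split=> [[Md <-] i j|Md].
  rewrite derive_mx// mxE; apply/derivableP.
  by move/derivable_mxP : Md; exact.
have dM' : derivable M y v by apply/derivable_mxP => i j; have [] := Md i j.
split=> //; rewrite derive_mx//; apply/matrixP => i j; rewrite mxE.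
by have [] := Md i j.
Qed.

Lemma is_derive_mulmx (V : normedModType R) p q r (A : V -> 'M[R]_(p, q))
    (B : V -> 'M[R]_(q, r)) dA dB (y v : V) :
  is_derive y v A dA -> is_derive y v B dB ->
  is_derive y v (fun z => A z *m B z) (dA *m B y + A y *m dB).
Proof.
move=> /is_derive_mxP Ad /is_derive_mxP Bd; apply/is_derive_mxP => i j.
under eq_fun do rewrite mxE.
rewrite !mxE -big_split/=; apply: is_derive_bigsum => k _.
exact: is_derive_mul.
Qed.

Lemma is_derive_trmx (V : normedModType R) p q (A : V -> 'M[R]_(p, q)) dA (y v : V) :
  is_derive y v A dA -> is_derive y v (fun z => (A z)^T) dA^T.
Proof.
move=> /is_derive_mxP Ad; apply/is_derive_mxP => i j.
by under eq_fun do rewrite mxE; rewrite mxE.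
Qed.

Lemma derivable_det (V : normedModType R) p (A : V -> 'M[R]_p) (y v : V) :
  derivable A y v -> derivable (fun z => \det (A z)) y v.
Proof.
move=> /derivable_mxP Ad.
suff H : is_derive y v (fun z => \det (A z))
    (\sum_(s : 'S_p) 'D_v (fun z => (-1) ^+ s * \prod_i A z i (s i)) y).
  by case: H.
apply: is_derive_bigsum => s _; apply/derivableP; apply: derivableM => //.
exact: derivable_bigprod.
Qed.

(** Cramer's formula gives derivability, and differentiating A A^-1 = 1 then gives the value.
    Invertibility is asked near [y] because [invmx] returns a singular matrix unchanged. *)
Lemma is_derive_invmx (V : normedModType R) p (A : V -> 'M[R]_p) dA (y v : V) :
  (\near y, A y \in unitmx) -> is_derive y v A dA ->
  is_derive y v (fun z => invmx (A z)) (- (invmx (A y) *m dA *m invmx (A y))).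
Proof.
move=> Au Ad; have Auy := nbhs_singleton Au.
have Bd : derivable (fun z => invmx (A z)) y v.
  apply: (@near_eq_derivable _ _ _ (fun z => (\det (A z))^-1 *: \adj (A z))).
    by near=> z; rewrite /invmx ifT//; near: z.
  apply/derivable_mxP => i j; under eq_fun do rewrite !mxE.
  have Ad' : derivable A y v by case: Ad.
  apply: derivableM.
    apply: derivableV; last exact: derivable_det.
    by move: Auy; rewrite unitmxE unitfE.
  apply: derivableM => //; apply: derivable_det.
  apply/derivable_mxP => k l; under eq_fun do rewrite !mxE.
  by move/derivable_mxP : Ad'; exact.
have /is_derive_mulmx/(_ (derivableP Bd)) := Ad.
set B' := 'D_v _ y => H1.
have H2 : is_derive y v (fun z => A z *m invmx (A z)) 0.
  apply: (@near_eq_is_derive _ _ _ (cst 1%:M)).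
    by near=> z; rewrite mulmxV//; near: z.
have E : dA *m invmx (A y) + A y *m B' = 0.
  by have [_ <-] := H1; have [_ <-] := H2.
split => //; rewrite -/B'; apply/eqP; rewrite -addr_eq0 addrC -mulmxA.
have := congr1 (mulmx (invmx (A y))) E.
by rewrite mulmxDr mulKmx// mulmx0 => /eqP.
Unshelve. all: by end_near. Qed.

Lemma differentiable_mx (V : normedModType R) p q (M : V -> 'M[R]_(p, q)) (y : V) :
  (forall i j, differentiable (fun z => M z i j) y) -> differentiable M y.
Proof.
move=> Md.
have -> : M = \sum_i \sum_j (fun z => M z i j *: delta_mx i j).
  apply/funext => z; rewrite [LHS]matrix_sum_delta fct_sumE.
  by apply: eq_bigr => i _; rewrite fct_sumE.
apply: differentiable_sum => i; apply: differentiable_sum => j.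
exact: differentiableZl.
Qed.

Lemma differentiable_mxE (V : normedModType R) p q (M : V -> 'M[R]_(p, q)) (y : V) i j :
  differentiable M y -> differentiable (fun z => M z i j) y.
Proof.
move=> Md; apply: (@differentiable_comp _ _ _ _ M (fun N => N i j)) => //.
exact: differentiable_coord.
Qed.

Lemma row_sum_evec n (a : 'rV[R]_n) : a = \sum_k a 0 k *: evec R k.
Proof. exact: row_sum_delta. Qed.

(** The differential of [g] is linear, so its value at [dF] expands along the axes, where it is
    given by the partial derivatives. *)
Lemma chain_rule (V W : normedModType R) n (F : V -> 'rV[R]_n) (g : 'rV[R]_n -> W)
    (y v : V) dF : differentiable F y -> differentiable g (F y) ->
  is_derive y v F dF ->
  is_derive y v (fun z => g (F z)) (\sum_k dF 0 k *: partial k g (F y)).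
Proof.
move=> Fd gd [_ FE]; split.
  by apply: diff_derivable; exact: differentiable_comp.
rewrite -[X in 'D_v X y]/(g \o F) deriveE; last exact: differentiable_comp.
have dFE : 'd F y v = dF by rewrite -deriveE.
rewrite diff_comp//= dFE {1}(row_sum_evec dF) linear_sum.
by apply: eq_bigr => k _; rewrite linearZ/= /partial deriveE.
Qed.

Lemma smooth_is_derive n (W : normedModType R) (U : set 'rV[R]_n)
    (f : 'rV[R]_n -> W) i z :
  smooth_on U f -> U z -> is_derive z (evec R i) f (partial i f z).
Proof. by move=> /(_ 1 i)[fd _] Uz; apply/derivableP/fd. Qed.

Lemma smooth_partial n (W : normedModType R) (U : set 'rV[R]_n)
    (f : 'rV[R]_n -> W) i :
  smooth_on U f -> smooth_on U (partial i f).
Proof. by move=> fs k; have [] := fs k.+1 i. Qed.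

Lemma smooth_continuous n (W : normedModType R) (U : set 'rV[R]_n)
    (f : 'rV[R]_n -> W) z :
  smooth_on U f -> U z -> {for z, continuous f}.
Proof. by move=> /(_ 0%N); exact. Qed.

Lemma smooth_differentiable n p q (U : set 'rV[R]_n) (f : 'rV[R]_n -> 'M[R]_(p, q)) z :
  open U -> smooth_on U f -> U z -> differentiable f z.
Proof.
move=> oU fs Uz; apply: differentiable_mx => i j.
apply: (@differentiable_C1 _ _ _ (fun k z => partial k f z i j) U) => //.
  by move=> k w Uw; have /is_derive_mxP := smooth_is_derive k fs Uw; exact.
move=> k; apply: (@continuous_comp _ _ _ (partial k f) (fun N : 'M[R]_(p, q) => N i j)).
  exact: smooth_continuous (smooth_partial k fs) Uz.
exact: coord_continuous.
Qed.

Lemma smooth_partialC n p q (U : set 'rV[R]_n) (f : 'rV[R]_n -> 'M[R]_(p, q)) i j z :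
  open U -> smooth_on U f -> U z ->
  partial i (partial j f) z = partial j (partial i f) z.
Proof.
move=> oU fs Uz; apply/matrixP => k l.
have D i' j' w : U w -> is_derive w (evec R i') (fun z => partial j' f z k l)
    (partial i' (partial j' f) w k l).
  move=> Uw; have /is_derive_mxP := smooth_is_derive i' (smooth_partial j' fs) Uw.
  exact.
have C i' j' : {for z, continuous (fun z => partial i' (partial j' f) z k l)}.
  apply: (@continuous_comp _ _ _ (partial i' (partial j' f)) (fun N : 'M[R]_(p, q) => N k l)).
    exact: smooth_continuous (smooth_partial i' (smooth_partial j' fs)) Uz.
  exact: coord_continuous.
apply: (@derive_comm _ _ (fun z => f z k l) (fun z => partial j f z k l)
  (fun z => partial i f z k l) (fun z => partial i (partial j f) z k l)
  (fun z => partial j (partial i f) z k l) U z (evec R j) (evec R i)) => //.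
- by move=> w Uw; have /is_derive_mxP := smooth_is_derive j fs Uw; exact.
- by move=> w Uw; have /is_derive_mxP := smooth_is_derive i fs Uw; exact.
Qed.

Lemma jacobianE m n (F : 'rV[R]_m -> 'rV[R]_n) y : differentiable F y ->
  'J F y = \matrix_(i, k) partial i F y 0 k.
Proof.
move=> Fd; apply/row_matrixP => i; rewrite rowE -deriveEjacobian//.
by apply/rowP => k; rewrite !mxE.
Qed.

End MatrixCalculus.

(** * Positive definite matrices; rules for scalings, compositions and blocks *)

Section Derivatives.
Context {R : realType}.

(** A nonzero row of the kernel would have zero square. *)
Lemma posdef_unitmx n (A : 'M[R]_n) :
  (forall v, v != 0 -> 0 < inner A v v) -> A \in unitmx.
Proof.
move=> Apos; rewrite -row_free_unit -kermx_eq0 -nz_row_eq0; apply: contraT => v0.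
have := Apos _ v0; rewrite /inner.
have /sub_kermxP -> : (nz_row (kermx A) <= kermx A)%MS by exact: nz_row_sub.
by rewrite mul0mx mxE ltxx.
Qed.

Lemma is_derive_comp1 (V W : normedModType R) (f : V -> R) (g : R -> W) (y v : V) df :
  differentiable f y -> is_derive y v f df -> derivable g (f y) 1 ->
  is_derive y v (fun z => g (f z)) (df *: 'D_1 g (f y)).
Proof.
move=> fd [_ <-] /derivable1_diffP gd; split.
  by apply: diff_derivable; exact: differentiable_comp.
rewrite -[X in 'D_v X y]/(g \o f) deriveE; last exact: differentiable_comp.
by rewrite diff_comp//= diff1E// derive1E -deriveE.
Qed.

Lemma is_derive_scale (V : normedModType R) p q (f : V -> R)
    (M : V -> 'M[R]_(p, q)) (y v : V) df dM :
  is_derive y v f df -> is_derive y v M dM ->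
  is_derive y v (fun z => f z *: M z) (df *: M y + f y *: dM).
Proof.
move=> fd /is_derive_mxP Md; apply/is_derive_mxP => i j.
by under eq_fun do rewrite mxE; rewrite !mxE; exact: is_derive_mul.
Qed.

Lemma is_derive_linear (V W : normedModType R) (f : {linear V -> W}) (y v : V) :
  continuous f -> is_derive y v f (f v).
Proof.
move=> fc; have fd := linear_differentiable y fc.
by split; [exact: diff_derivable|rewrite deriveE// diff_lin].
Qed.

Lemma is_derive_block (V : normedModType R) p q (A : 'M[R]_p) (D : V -> 'M[R]_q)
    dD (y v : V) : is_derive y v D dD ->
  is_derive y v (fun z => block_mx A 0 0 (D z)) (block_mx 0 0 0 dD).
Proof.
move=> /is_derive_mxP Dd; apply/is_derive_mxP => i j.
case: (split_ordP i) => i' ->; case: (split_ordP j) => j' ->.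
- by under eq_fun do rewrite block_mxEul; rewrite block_mxEul mxE; exact: is_derive_cst.
- by under eq_fun do rewrite block_mxEur; rewrite block_mxEur mxE; exact: is_derive_cst.
- by under eq_fun do rewrite block_mxEdl; rewrite block_mxEdl mxE; exact: is_derive_cst.
- by under eq_fun do rewrite block_mxEdr; rewrite block_mxEdr.
Qed.

Lemma differentiable_block (V : normedModType R) p q (A : 'M[R]_p)
    (D : V -> 'M[R]_q) (y : V) : differentiable D y ->
  differentiable (fun z => block_mx A 0 0 (D z)) y.
Proof.
move=> Dd; apply: differentiable_mx => i j.
case: (split_ordP i) => i' ->; case: (split_ordP j) => j' ->.
- by under eq_fun do rewrite block_mxEul; exact: differentiable_cst.
- by under eq_fun do rewrite block_mxEur; exact: differentiable_cst.
- by under eq_fun do rewrite block_mxEdl; exact: differentiable_cst.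
- by under eq_fun do rewrite block_mxEdr; exact: differentiable_mxE.
Qed.

Lemma differentiable_scale (V : normedModType R) p q (f : V -> R)
    (M : V -> 'M[R]_(p, q)) (y : V) :
  differentiable f y -> differentiable M y ->
  differentiable (fun z => f z *: M z) y.
Proof.
move=> fd Md; apply: differentiable_mx => i j.
under eq_fun do rewrite mxE.
by apply: differentiableM => //; exact: differentiable_mxE.
Qed.

End Derivatives.

(** * The fundamental theorem of calculus for the oriented integral *)

Section OrientedIntegral.
Context {R : realType}.

(** Openness of [I] provides [a] below and [b] above both [t0] and [t], and convexity keeps [[a, b]]
    in [I]. For [s] near [t], on either side of [t0], the oriented integral is [Phi s - Phi t0] with
    [Phi] the integral from [a], to which the one-sided theorem applies. *)
Lemma is_derive_oriented_integral (I : set R) (h : R -> R) (t0 t : R) :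
  open I -> is_interval I -> (forall s, I s -> {for s, continuous h}) ->
  I t0 -> I t -> is_derive t (1 : R) (oriented_integral h t0) (h t).
Proof.
move=> oI itvI hc It0 It.
have [a Ia [at0 at_]] : exists2 a, I a & a < t0 /\ a < t.
  have [s Is [st0 st]] : exists2 s, I s & s <= t0 /\ s <= t.
    by have [tt0|/ltW tt0] := leP t t0; [exists t|exists t0].
  have /nbhs_ballP[e /= e0 eI] := open_nbhs_nbhs (conj oI Is).
  exists (s - e / 2); last by split; lra.
  by apply: eI; rewrite -ball_normE/= opprB addrC subrK gtr0_norm; lra.
have [b Ib [bt0 bt]] : exists2 b, I b & t0 < b /\ t < b.
  have [s Is [st0 st]] : exists2 s, I s & t0 <= s /\ t <= s.
    by have [tt0|/ltW tt0] := leP t t0; [exists t0|exists t].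
  have /nbhs_ballP[e /= e0 eI] := open_nbhs_nbhs (conj oI Is).
  exists (s + e / 2); last by split; lra.
  by apply: eI; rewrite -ball_normE/= opprD addrA subrr sub0r normrN gtr0_norm; lra.
have hint c d : a <= c -> d <= b ->
    (@lebesgue_measure R).-integrable `[c, d] (EFin \o h).
  move=> ac db; apply: continuous_compact_integrable; first exact: segment_compact.
  apply: continuous_in_subspaceT => s /[!inE]/=; rewrite in_itv/= => /andP[cs sd].
  by apply: hc; apply: (itvI _ _ Ia Ib); rewrite (le_trans ac cs) (le_trans sd db).
pose Phi s := \int[lebesgue_measure]_(r in `[a, s]) h r.
have PhiB r s : a <= r -> r <= s -> s <= b ->
    \int[lebesgue_measure]_(q in `[r, s]) h q = Phi s - Phi r.
  move=> ar rs sb; rewrite /Phi Rintegral_itvB ?bnd_simp//; last exact: hint.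
  rewrite Rintegral_itv_obnd_cbnd//; apply: integrableS (hint _ _ ar sb) => //.
  exact: subset_itv_oc_cc.
have [Phid PhiE] : derivable Phi t 1 /\ derive1 Phi t = h t.
  by apply: (continuous_FTC1_closed bt) => //; [exact: hint|exact: hc].
apply: (@near_eq_is_derive _ _ _ (fun s => Phi s - Phi t0)).
  near=> s.
  have as_ : a < s by near: s; exact: lt_nbhsr.
  have sb : s < b by near: s; exact: lt_nbhsl.
  rewrite /oriented_integral; have [ts|/ltW ts] := leP t0 s.
    by rewrite PhiB// ltW.
  by rewrite PhiB ?opprB// ltW.
have Phi' : is_derive t (1 : R) Phi (h t) by split; [exact: Phid|rewrite -derive1E].
by apply: is_derive_eq; rewrite subr0.
Unshelve. all: by end_near. Qed.

End OrientedIntegral.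

(** * The Levi-Civita connection in coordinates *)

(* [v *m connection G y a] is the zeroth-order part of the covariant derivative of
   a field with value [v] at [y] in the direction [a]. *)
Definition connection (R : realType) (n : nat) (G : 'rV[R]_n -> 'M[R]_n)
    (y a : 'rV[R]_n) : 'M[R]_n :=
  \matrix_(q, k) \sum_p christoffel G y k p q * a 0 p.

Section LeviCivita.
Context {R : realType} {n : nat} (G : 'rV[R]_n -> 'M[R]_n) (y : 'rV[R]_n).
Hypothesis Gd : forall i, derivable G y (evec R i).
Hypothesis Gsym : \forall z \near y, (G z)^T = G z.
Hypothesis Gunit : G y \in unitmx.

Let dG (i : 'I_n) : 'M[R]_n := partial i G y.

Lemma partial_metricE i j l : partial i (fun z => G z j l) y = dG i j l.
Proof. by rewrite /dG /partial derive_mx// mxE. Qed.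

Lemma partial_metric_sym i j l : dG i j l = dG i l j.
Proof.
rewrite -!partial_metricE; apply: near_eq_derive.
near=> z; suff {1}<- : (G z)^T = G z by rewrite mxE.
by near: z.
Unshelve. all: by end_near. Qed.

Lemma metric_sym : (G y)^T = G y.
Proof. exact: nbhs_singleton Gsym. Qed.

Lemma invmx_metric_sym i j : invmx (G y) i j = invmx (G y) j i.
Proof. by rewrite -[in LHS]metric_sym -trmx_inv mxE. Qed.

Lemma christoffelE k i j : christoffel G y k i j =
  2^-1 * \sum_l invmx (G y) k l * (dG i j l + dG j i l - dG l i j).
Proof.
by congr (_ * _); apply: eq_bigr => l _; rewrite !partial_metricE.
Qed.

Lemma christoffel_rowE i j : \row_k christoffel G y k i j =
  2^-1 *: (\row_l (dG i j l + dG j i l - dG l i j)) *m invmx (G y).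
Proof.
apply/rowP => k; rewrite -scalemxAl !mxE christoffelE; congr (_ * _).
by apply: eq_bigr => l _; rewrite !mxE mulrC invmx_metric_sym.
Qed.

Lemma christoffelC k i j : christoffel G y k i j = christoffel G y k j i.
Proof.
rewrite !christoffelE; have S := partial_metric_sym; clearbody dG.
by congr (_ * _); apply: eq_bigr => l _; rewrite (S l i j) [dG i j l + _]addrC.
Qed.

(** These are the Christoffel symbols of the first kind, free of the inverse metric. *)
Lemma christoffel_lower p q s : \sum_k christoffel G y k p q * G y k s =
  2^-1 * (dG p q s + dG q p s - dG s p q).
Proof.
have := congr1 (fun v => (v *m G y) 0 s) (christoffel_rowE p q).
by rewrite mulmxKV// !mxE => <-; apply: eq_bigr => k _; rewrite !mxE.
Qed.

(** Metric compatibility: adding to a symbol of the first kind its transpose in [q] and [s] cancels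
    everything but [dG p q s]. *)
Lemma connection_compatible (a : 'rV[R]_n) :
  \sum_r a 0 r *: dG r = connection G y a *m G y + G y *m (connection G y a)^T.
Proof.
have L q s : (connection G y a *m G y) q s =
    \sum_p a 0 p * (2^-1 * (dG p q s + dG q p s - dG s p q)).
  rewrite mxE; under eq_bigr => k _ do rewrite mxE mulr_suml.
  rewrite exchange_big/=; apply: eq_bigr => p _.
  rewrite -christoffel_lower mulr_sumr; apply: eq_bigr => k _.
  by rewrite mulrAC mulrC mulrA.
have -> : G y *m (connection G y a)^T = (connection G y a *m G y)^T.
  by rewrite trmx_mul metric_sym.
apply/matrixP => q s; rewrite [RHS]mxE [X in _ + X]mxE !L -big_split/=.
rewrite summxE; apply: eq_bigr => p _; rewrite mxE -mulrDr; congr (_ * _).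
have S := partial_metric_sym; clear L; clearbody dG.
by rewrite (S p s q); lra.
Qed.

(** Vanishing torsion, in matrix form. *)
Lemma connectionC (a b : 'rV[R]_n) : a *m connection G y b = b *m connection G y a.
Proof.
apply/rowP => k; rewrite !mxE.
under eq_bigr => q _ do rewrite mxE mulr_sumr.
under [RHS]eq_bigr => q _ do rewrite mxE mulr_sumr.
rewrite exchange_big/=; apply: eq_bigr => p _; apply: eq_bigr => q _.
by rewrite christoffelC mulrCA mulrA mulrC mulrA.
Qed.

End LeviCivita.

Lemma sum3_rot (R : realType) n (f : 'I_n -> 'I_n -> 'I_n -> R) :
  \sum_i \sum_j \sum_l f i j l = \sum_i \sum_j \sum_l f l j i.
Proof.
rewrite [RHS]exchange_big/=.
under [RHS]eq_bigr => j _ do rewrite exchange_big/=.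
by rewrite [RHS]exchange_big.
Qed.

(** The divergence of the gradient is the trace of the Hessian. Beyond the second derivatives of
    [u], both sides consist of contractions of [dG] with the inverse metric [gi] and the gradient
    [w]. *)
Lemma laplacianE (R : realType) n (G : 'rV[R]_n -> 'M[R]_n) (u : 'rV[R]_n -> R)
    (y : 'rV[R]_n) (du : 'I_n -> 'rV[R]_n) :
  (forall i, derivable G y (evec R i)) ->
  (\forall z \near y, (G z)^T = G z) ->
  (\forall z \near y, G z \in unitmx) ->
  (forall i, is_derive y (evec R i) (fun z => \row_j partial j u z) (du i)) ->
  laplacian G u y = \sum_i \sum_j invmx (G y) i j *
    (du i 0 j - \sum_k christoffel G y k i j * partial k u y).
Proof.
move=> Gd Gsym Gu ud; have Guy := nbhs_singleton Gu.
pose gi := invmx (G y); pose dG (i : 'I_n) : 'M[R]_n := partial i G y.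
pose ug := \row_j partial j u y; pose w := ug *m gi.
have gC i j : gi i j = gi j i := invmx_metric_sym Gsym i j.
have dGC i j l : dG i j l = dG i l j := partial_metric_sym Gd Gsym i j l.
have grad i : partial i (gradient G u) y = du i *m gi - w *m dG i *m gi.
  have Gdi : is_derive y (evec R i) G (dG i) by exact/derivableP.
  have [_] := is_derive_mulmx (ud i) (is_derive_invmx Gu Gdi).
  by rewrite /partial => ->; rewrite mulmxN !mulmxA.
have gam i j : \sum_k christoffel G y k i j * partial k u y =
    2^-1 * \sum_l w 0 l * (dG i j l + dG j i l - dG l i j).
  transitivity (((\row_k christoffel G y k i j) *m ug^T) 0 0).
    by rewrite mxE; apply: eq_bigr => k _; rewrite !mxE.
  rewrite christoffel_rowE// -!scalemxAl mxE; congr (_ * _).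
  have -> : w = (gi *m ug^T)^T.
    by rewrite trmx_mul trmxK; congr (_ *m _); apply/matrixP => k l; rewrite mxE gC.
  rewrite -mulmxA mxE; apply: eq_bigr => l _; rewrite mulrC.
  by congr (_ * _); [rewrite [RHS]mxE|rewrite mxE].
have chE k i j : christoffel G y k i j =
  2^-1 * \sum_l gi k l * (dG i j l + dG j i l - dG l i j) := christoffelE Gd k i j.
rewrite /laplacian /divergence.
under eq_bigr => i _ do rewrite grad.
have -> : \sum_i ((du i *m gi - w *m dG i *m gi) 0 i +
     \sum_j christoffel G y i i j * gradient G u y 0 j) =
  \sum_i (du i *m gi) 0 i - \sum_i (w *m dG i *m gi) 0 i +
  \sum_i \sum_j christoffel G y i i j * w 0 j.
  by rewrite -sumrB -big_split/=; apply: eq_bigr => i _; rewrite !mxE.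
under [RHS]eq_bigr => i _ do under eq_bigr => j _ do rewrite mulrBr gam.
under [RHS]eq_bigr => i _ do rewrite sumrB.
rewrite sumrB -addrA; congr (_ + _).
  apply: eq_bigr => i _; rewrite mxE; apply: eq_bigr => j _.
  by rewrite mulrC gC.
clearbody dG.
(* Up to symmetry only two contractions occur: the differentiation index of [dG] meets [gi] in [S1]
   and [w] in [S2]. Both sides come out as [S2 / 2 - S1]. *)
pose S1 := \sum_i \sum_j \sum_l gi i j * w 0 l * dG i j l.
pose S2 := \sum_i \sum_j \sum_l gi i j * w 0 l * dG l i j.
have E1 : \sum_i (w *m dG i *m gi) 0 i = S1.
  apply: eq_bigr => i _; rewrite mxE; apply: eq_bigr => j _.
  rewrite mxE mulr_suml; apply: eq_bigr => l _.
  by rewrite dGC gC mulrC mulrA.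
have E1' : \sum_i \sum_j \sum_l gi i j * w 0 l * dG j i l = S1.
  rewrite exchange_big/=; apply: eq_bigr => i _; apply: eq_bigr => j _.
  by apply: eq_bigr => l _; rewrite gC.
have E2 : \sum_i \sum_j gi i j * (2^-1 * \sum_l w 0 l *
    (dG i j l + dG j i l - dG l i j)) = 2^-1 * (S1 + S1 - S2).
  rewrite -[X in _ * (_ + X - _)]E1' -big_split -sumrB mulr_sumr; apply: eq_bigr => i _.
  rewrite -big_split -sumrB mulr_sumr; apply: eq_bigr => j _.
  rewrite -big_split -sumrB/= mulrCA mulr_sumr; congr (_ * _).
  by apply: eq_bigr => l _; ring.
have E3 : \sum_i \sum_j christoffel G y i i j * w 0 j = 2^-1 * S2.
  have E3a : \sum_i \sum_j \sum_l gi i l * w 0 j * dG j i l = S2.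
    apply: eq_bigr => i _; exact: exchange_big.
  (* In the traced symbol the first and third terms of the Koszul combination cancel after
     exchanging [i] and [l], leaving the logarithmic derivative of the volume density. *)
  have E3b : \sum_i \sum_j \sum_l gi i l * w 0 j * dG i j l =
      \sum_i \sum_j \sum_l gi i l * w 0 j * dG l i j.
    rewrite sum3_rot; apply: eq_bigr => i _; apply: eq_bigr => j _.
    by apply: eq_bigr => l _; rewrite gC dGC.
  transitivity (2^-1 * (\sum_i \sum_j \sum_l gi i l * w 0 j * dG i j l +
     \sum_i \sum_j \sum_l gi i l * w 0 j * dG j i l -
     \sum_i \sum_j \sum_l gi i l * w 0 j * dG l i j)).
    rewrite -big_split -sumrB mulr_sumr; apply: eq_bigr => i _.
    rewrite -big_split -sumrB mulr_sumr; apply: eq_bigr => j _.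
    rewrite chE -mulrA; congr (_ * _).
    rewrite -big_split -sumrB/= mulr_suml.
    by apply: eq_bigr => l _; ring.
  by rewrite E3a E3b addrAC subrr add0r.
rewrite -/gi E1 E2 E3; clearbody S1 S2; lra.
Qed.

Section Connection.
Context {R : realType} {n : nat} (G : 'rV[R]_n -> 'M[R]_n) (z : 'rV[R]_n).

Lemma connection_evec p q k :
  connection G z (evec R p) q k = christoffel G z k p q.
Proof.
rewrite mxE (bigD1 p)//= mxE !eqxx mulr1 big1 ?addr0// => i ip.
by rewrite mxE (negbTE ip) andbF mulr0.
Qed.

Lemma connection_sum (a : 'rV[R]_n) :
  connection G z a = \sum_k a 0 k *: connection G z (evec R k).
Proof.
apply/matrixP => q k; rewrite mxE summxE; apply: eq_bigr => p _.
by rewrite mxE connection_evec mulrC.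
Qed.

Lemma divergenceE (X : 'rV[R]_n -> 'rV[R]_n) : divergence G X z =
  \sum_i (partial i X z + X z *m connection G z (evec R i)) 0 i.
Proof.
apply: eq_bigr => i _; rewrite mxE; congr (_ + _).
by rewrite mxE; apply: eq_bigr => j _; rewrite connection_evec mulrC.
Qed.

End Connection.

(** * Immersions *)

Section Inner.
Context {R : realType} {n : nat}.
Implicit Types (g : 'M[R]_n) (v w : 'rV[R]_n).

Lemma innerDr g v w1 w2 : inner g v (w1 + w2) = inner g v w1 + inner g v w2.
Proof. by rewrite /inner linearD mulmxDr mxE. Qed.

Lemma innerZr g v w a : inner g v (a *: w) = a * inner g v w.
Proof. by rewrite /inner linearZ -scalemxAr mxE. Qed.

Lemma innerBr g v w1 w2 : inner g v (w1 - w2) = inner g v w1 - inner g v w2.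
Proof. by rewrite innerDr -scaleN1r innerZr mulN1r. Qed.

Lemma inner_sumr g v (J : Type) (r : seq J) (w : J -> 'rV[R]_n) :
  inner g v (\sum_(j <- r) w j) = \sum_(j <- r) inner g v (w j).
Proof.
elim/big_rec2 : _ => [|j a b _ <-]; last exact: innerDr.
by rewrite -(scale0r 0) innerZr mul0r.
Qed.

Lemma innerC g v w : g^T = g -> inner g v w = inner g w v.
Proof.
by move=> gS; rewrite /inner -[in LHS](trmxK (_ *m _)) mxE !trmx_mul trmxK gS mulmxA.
Qed.

End Inner.

Section Immersion.
Context {R : realType} {m n : nat}.
Variables (G : 'rV[R]_m -> 'M[R]_m) (Gbar : 'rV[R]_n -> 'M[R]_n).
Variables (F : 'rV[R]_m -> 'rV[R]_n) (V : set 'rV[R]_m) (y : 'rV[R]_m).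
Hypotheses (oV : open V) (Vy : V y) (Fs : smooth_on V F).
Hypothesis Gunit : forall z, V z -> G z \in unitmx.
Hypothesis Gpull : forall z, V z -> G z = pullback F Gbar z.
Hypothesis Gbard : differentiable Gbar (F y).
Hypothesis Gbarsym : \forall z \near F y, (Gbar z)^T = Gbar z.
Hypothesis Gbarunit : Gbar (F y) \in unitmx.

Let J z : 'M[R]_(m, n) := \matrix_(j, k) partial j F z 0 k.
Let omega i := connection Gbar (F y) (partial i F y).
Let dJ i : 'M[R]_(m, n) := \matrix_(j, k) partial i (partial j F) y 0 k.
(** Row [j] is D_ij. Keeping all [j] in one matrix turns the Gauss formula and the Hessian into
    matrix identities. *)
Let DJ i : 'M[R]_(m, n) := dJ i + J y *m omega i.

Let row_J i z : row i (J z) = partial i F z.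
Proof. by apply/rowP => k; rewrite !mxE. Qed.

Let F_differentiable z : V z -> differentiable F z.
Proof. exact: smooth_differentiable oV Fs. Qed.

Let near_V : \forall z \near y, V z.
Proof. exact: open_nbhs_nbhs. Qed.

Let J_derive i : is_derive y (evec R i) J (dJ i).
Proof.
apply/is_derive_mxP => j k; rewrite mxE.
under eq_fun do rewrite mxE.
have /is_derive_mxP := smooth_is_derive i (smooth_partial j Fs) Vy.
exact.
Qed.

Let row_dJ i j : row j (dJ i) = partial i (partial j F) y.
Proof. by apply/rowP => k; rewrite !mxE. Qed.

Let Gbar_derivable i : derivable Gbar (F y) (evec R i).
Proof. exact: diff_derivable. Qed.

Let row_DJ i j : row j (DJ i) = partial i (partial j F) y + partial j F y *m omega i.
Proof. by rewrite [LHS]linearD/= (row_dJ i j) row_mul (row_J j y). Qed.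

Let cov_derivE i j : cov_deriv Gbar F y i j = row j (DJ i).
Proof.
rewrite row_DJ; congr (_ + _).
apply/rowP => k; rewrite !mxE exchange_big/=; apply: eq_bigr => q _.
rewrite mxE mulr_sumr; apply: eq_bigr => p _; exact: mulrC.
Qed.

(** Second partials of F commute, and the connection of the target has no torsion. *)
Let DJC i j : row j (DJ i) = row i (DJ j).
Proof.
etransitivity; first exact: row_DJ.
symmetry.
etransitivity; first exact: row_DJ.
apply: (f_equal2 +%R).
  exact: smooth_partialC oV Fs Vy.
exact: connectionC.
Qed.

(** Product rule for the metric along F: compatibility splits the derivative of [Gbar (F z)] into
    two terms, and each completes the derivative of one factor to a covariant derivative. The sizes
    [p] and [q] are free so that it applies to J with J and to X with J. *)
Lemma inner_along_derive p q (A : 'rV[R]_m -> 'M[R]_(p, n))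
    (B : 'rV[R]_m -> 'M[R]_(q, n)) dA dB i :
  is_derive y (evec R i) A dA -> is_derive y (evec R i) B dB ->
  is_derive y (evec R i) (fun z => A z *m Gbar (F z) *m (B z)^T)
    ((dA + A y *m omega i) *m Gbar (F y) *m (B y)^T +
     A y *m Gbar (F y) *m (dB + B y *m omega i)^T).
Proof.
move=> Ad Bd.
have Gd := chain_rule (F_differentiable Vy) Gbard (smooth_is_derive i Fs Vy).
rewrite connection_compatible// -/(omega i) in Gd.
have := is_derive_mulmx (is_derive_mulmx Ad Gd) (is_derive_trmx Bd).
move=> /is_derive_eq; apply.
rewrite [(dB + _)^T]linearD/= trmx_mul !mulmxDr !mulmxDl !mulmxA -!addrA.
congr (_ + _); congr (_ + _); exact: addrC.
Qed.

Let GE z : V z -> G z = J z *m Gbar (F z) *m (J z)^T.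
Proof. by move=> Vz; rewrite Gpull// /pullback jacobianE//; exact: F_differentiable. Qed.

Let G_derive i : is_derive y (evec R i) G
  (DJ i *m Gbar (F y) *m (J y)^T + J y *m Gbar (F y) *m (DJ i)^T).
Proof.
apply: (@near_eq_is_derive _ _ _ (fun z => J z *m Gbar (F z) *m (J z)^T)).
  by near=> z; rewrite GE//; near: z.
exact: inner_along_derive.
Unshelve. all: by end_near. Qed.

Let G_sym : \forall z \near y, (G z)^T = G z.
Proof.
have : \forall z \near y, (Gbar (F z))^T = Gbar (F z).
  exact: (differentiable_continuous (F_differentiable Vy)) Gbarsym.
move=> S; near=> z; rewrite GE; last by near: z.
rewrite !trmx_mul trmxK mulmxA; congr (_ *m _ *m _).
by near: z.
Unshelve. all: by end_near. Qed.

Let Gbar_symy : (Gbar (F y))^T = Gbar (F y).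
Proof. exact: nbhs_singleton Gbarsym. Qed.

(** Koszul's argument. With [T k l s] = <D_kl, F_s>, the product rule gives
    [dG k l s = T k l s + T k s l]. *)
Let gauss_formula i j : \row_k christoffel G y k i j =
  row j (DJ i) *m Gbar (F y) *m (J y)^T *m invmx (G y).
Proof.
have Gd k : derivable G y (evec R k) by case: (G_derive k).
pose dG k l s := partial k G y l s.
have -> : \row_k christoffel G y k i j =
    2^-1 *: (\row_l (dG i j l + dG j i l - dG l i j)) *m invmx (G y).
  exact: christoffel_rowE.
congr (_ *m _).
have dGk k : partial k G y = DJ k *m Gbar (F y) *m (J y)^T + (DJ k *m Gbar (F y) *m (J y)^T)^T.
  have [_ ] := G_derive k; rewrite /partial => ->; congr (_ + _).
  by rewrite !trmx_mul trmxK Gbar_symy mulmxA.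
pose T k := DJ k *m Gbar (F y) *m (J y)^T.
have rowT k l : row l (T k) = row l (DJ k) *m Gbar (F y) *m (J y)^T.
  by rewrite /T (row_mul l) (row_mul l).
have TC k l s : T k l s = T l k s.
  transitivity (row l (T k) 0 s); first by rewrite [RHS]mxE.
  rewrite (rowT k l) (DJC k l) -(rowT l k); exact: mxE.
have dGE k l s : dG k l s = T k l s + T k s l.
  by rewrite /dG dGk mxE; congr (_ + _); rewrite mxE.
clear dGk; clearbody dG.
rewrite -(rowT i j); apply/rowP => l.
rewrite mxE [X in _ * X]mxE [RHS]mxE !dGE.
(* Symmetry of [T] in its first two indices pairs off four of the six Koszul terms; the other two
   both equal [T i j l], which absorbs the factor 1/2. *)
clear rowT; clearbody T; rewrite (TC j i l) (TC l i j) (TC l j i); lra.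
Qed.

(** The tangential projector, acting on row vectors from the right. It is idempotent because J Gbar
    J^T = G cancels an inverse, and self-adjoint for [Gbar] because G and [Gbar] are symmetric. *)
Let Pi : 'M[R]_n := Gbar (F y) *m (J y)^T *m invmx (G y) *m J y.

Let GVsym i j : invmx (G y) i j = invmx (G y) j i.
Proof. exact: invmx_metric_sym. Qed.

Let tangent_partE v : tangent_part G Gbar F y v = v *m Pi.
Proof.
rewrite /tangent_part /Pi !mulmxA [RHS]mulmx_sum_row; apply: eq_bigr => i _.
rewrite row_J -scaler_suml; congr (_ *: _); rewrite mxE; apply: eq_bigr => j _.
rewrite GVsym mulrC; congr (_ * _).
by rewrite -row_J /inner !mxE; apply: eq_bigr => k _; rewrite !mxE.
Qed.

Let PiPi : Pi *m Pi = Pi.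
Proof.
rewrite /Pi -!mulmxA; congr (_ *m (_ *m _)).
rewrite !mulmxA; congr (_ *m _).
rewrite -[RHS]mulmx1 -!mulmxA; congr (_ *m _).
by rewrite !mulmxA -GE// mulmxV// Gunit.
Qed.

Let PiG : Pi *m Gbar (F y) = Gbar (F y) *m Pi^T.
Proof.
have S : (invmx (G y))^T = invmx (G y) by apply/matrixP => i j; rewrite mxE GVsym.
by rewrite /Pi !trmx_mul trmxK Gbar_symy S !mulmxA.
Qed.

Let second_formE i j : second_form G Gbar F y i j = row j (DJ i) *m (1%:M - Pi).
Proof.
by rewrite /second_form /normal_part tangent_partE cov_derivE mulmxBr mulmx1.
Qed.

(** * A closed conformal field and its potential along the immersion *)

Section ConformalField.
Variables (X : 'rV[R]_n -> 'rV[R]_n) (u : 'rV[R]_m -> R) (lambda c : R).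
(** Conformality is asked at [y] in the directions F_i, with [lambda] the value of the conformal
    factor there. [Xgrad] is asked on all of [V], since the Hessian of [u] at [y] differentiates
    it. *)
Hypothesis Xderiv : forall i, derivable (fun z => X (F z)) y (evec R i).
Hypothesis Xconf : forall i, partial i (fun z => X (F z)) y + X (F y) *m omega i =
  lambda *: partial i F y.
Hypothesis Xgrad : forall j z, V z ->
  partial j u z = inner (Gbar (F z)) (X (F z)) (partial j F z).

Let Xy := X (F y).
Let H := mean_curvature G Gbar F y.

Let gradE z : V z -> \row_j partial j u z = X (F z) *m Gbar (F z) *m (J z)^T.
Proof.
move=> Vz; apply/rowP => j; rewrite mxE Xgrad//.
by rewrite -row_J /inner !mxE; apply: eq_bigr => k _; rewrite !mxE.
Qed.

Lemma laplacian_conformal :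
  laplacian G u y = m%:R * lambda + inner (Gbar (F y)) Xy H.
Proof.
have near_unit : \forall z \near y, G z \in unitmx.
  by near=> z; apply: Gunit; near: z.
have Gd k : derivable G y (evec R k) by case: (G_derive k).
have ud i : is_derive y (evec R i) (fun z => \row_j partial j u z)
    (lambda *: (partial i F y *m Gbar (F y) *m (J y)^T) +
     Xy *m Gbar (F y) *m (DJ i)^T).
  apply: (@near_eq_is_derive _ _ _ (fun z => X (F z) *m Gbar (F z) *m (J z)^T)).
    by near=> z; rewrite gradE//; near: z.
  have Xd := derivableP (@Xderiv i).
  have := inner_along_derive Xd (J_derive i).
  move=> /is_derive_eq; apply.
  rewrite -[X in X + _ *m omega i]/(partial i (fun z => X (F z)) y) Xconf.
  by rewrite -!scalemxAl.
rewrite (laplacianE Gd G_sym near_unit ud).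
(* By the Gauss formula the Christoffel term of the Hessian pairs [Xy] with the tangential part of
   D_ij, so only the second fundamental form is left. *)
have E i j : (lambda *: (partial i F y *m Gbar (F y) *m (J y)^T) +
     Xy *m Gbar (F y) *m (DJ i)^T) 0 j - \sum_k christoffel G y k i j * partial k u y
   = lambda * G y i j + inner (Gbar (F y)) Xy (second_form G Gbar F y i j).
  have -> : \sum_k christoffel G y k i j * partial k u y =
      inner (Gbar (F y)) Xy (row j (DJ i) *m Pi).
    transitivity (((\row_k christoffel G y k i j) *m (\row_k partial k u y)^T) 0 0).
      by rewrite mxE; apply: eq_bigr => k _; rewrite !mxE.
    rewrite gauss_formula gradE// /inner /Pi.
    rewrite -[in LHS](trmxK (_ *m _)) [LHS]mxE; congr (fun_of_matrix _ 0 0).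
    by rewrite !trmx_mul !trmxK !mulmxA.
  rewrite second_formE mulmxBr mulmx1 innerBr addrA; congr (_ - _).
  rewrite mxE; congr (_ + _).
    rewrite mxE GE//; congr (_ * _).
    by rewrite -(row_J i y) -!row_mul mxE.
  by rewrite mxE; apply/esym; rewrite /inner mxE; apply: eq_bigr => k _; rewrite !mxE.
under eq_bigr => i _ do under eq_bigr => j _ do rewrite E mulrDr.
under eq_bigr => i _ do rewrite big_split/=.
rewrite big_split/=; congr (_ + _).
  transitivity (\sum_(i < m) lambda); last first.
    by rewrite sumr_const card_ord mulr_natl.
  apply: eq_bigr => i _; have := congr1 (fun M : 'M[R]_m => M i i) (mulVmx (Gunit Vy)).
  rewrite !mxE eqxx mulr1n => e; rewrite -[RHS]mulr1 -e mulr_sumr; apply: eq_bigr => j _.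
  have /(congr1 (fun M : 'M[R]_m => M i j)) := metric_sym G_sym.
  by rewrite mxE => ->; exact: mulrCA.
rewrite /H /mean_curvature inner_sumr; apply: eq_bigr => i _.
by rewrite inner_sumr; apply: eq_bigr => j _; rewrite innerZr.
Unshelve. all: by end_near. Qed.

Hypothesis soliton : c *: normal_part G Gbar F y Xy = H.
Hypothesis c_neq0 : c != 0.
Hypothesis u_derivable : forall j, derivable u y (evec R j).

Let HE : H = c *: (Xy - Xy *m Pi).
Proof. by rewrite -soliton /normal_part tangent_partE. Qed.

(** Idempotence of [Pi] makes H normal, and self-adjointness makes [Xy *m Pi] orthogonal to H;
    pairing [Xy = c^-1 *: H + Xy *m Pi] with H leaves the first term. *)
Lemma inner_soliton :
  inner (Gbar (F y)) Xy H = c^-1 * inner (Gbar (F y)) H H.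
Proof.
have HPi : H *m Pi = 0.
  by rewrite HE -scalemxAl mulmxBl -mulmxA PiPi subrr scaler0.
have XPiH : inner (Gbar (F y)) (Xy *m Pi) H = 0.
  by rewrite /inner -(mulmxA Xy) PiG -!mulmxA -trmx_mul HPi trmx0 !mulmx0 mxE.
have XE : Xy = c^-1 *: H + Xy *m Pi.
  by rewrite HE scalerA mulVf// scale1r subrK.
rewrite (innerC _ _ Gbar_symy) {1}XE innerDr innerZr.
by rewrite [X in _ + X](innerC _ _ Gbar_symy) XPiH addr0.
Qed.

Theorem laplacian_soliton :
  laplacian G u y = m%:R * lambda + c^-1 * inner (Gbar (F y)) H H.
Proof. by rewrite laplacian_conformal inner_soliton. Qed.

Theorem weighted_laplacian_soliton :
  weighted_laplacian G (fun w => - c * u w) u y =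
  m%:R * lambda + c * inner (Gbar (F y)) Xy Xy.
Proof.
have gradf : gradient G (fun w => - c * u w) y = - c *: gradient G u y.
  rewrite /gradient scalemxAl; congr (_ *m _); apply/rowP => j; rewrite !mxE.
  exact: deriveMl.
(* One of the two inverses of G cancels, and what remains is [Pi] between two copies of X.
   Multiplied by [c], this restores the tangential part missing from <X, H> = c <X, X^perp>. *)
have grad2 : inner (G y) (gradient G u y) (gradient G u y) =
    inner (Gbar (F y)) Xy (Xy *m Pi).
  rewrite /inner /gradient gradE// mulmxKV ?Gunit// /Pi.
  by rewrite !trmx_mul !trmxK !mulmxA.
rewrite /weighted_laplacian laplacian_conformal gradf.
rewrite (innerC _ _ (metric_sym G_sym)) innerZr grad2 HE innerZr innerBr.
by ring.
Qed.

End ConformalField.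
End Immersion.

(** * Warped products *)

Definition tcoord (R : realType) (n : nat) (w : 'rV[R]_(1 + n)) : R :=
  lsubmx w 0 0.

(** For [g0] the metric of a chart of P this is convertible to the metric of its [warped_chart]. *)
Definition warped_metric (R : realType) (n : nat) (h : R -> R)
    (g0 : 'rV[R]_n -> 'M[R]_n) (w : 'rV[R]_(1 + n)) : 'M[R]_(1 + n) :=
  block_mx 1%:M 0 0 (h (tcoord w) ^+ 2 *: g0 (rsubmx w)).

Lemma tcoord_differentiable (R : realType) (n : nat) (w : 'rV[R]_(1 + n)) :
  differentiable (@tcoord R n) w.
Proof. exact/differentiable_mxE/differentiable_lsubmx. Qed.

Section WarpedMetric.
Context {R : realType} {n : nat}.
Variables (h : R -> R) (g0 : 'rV[R]_n -> 'M[R]_n) (z : 'rV[R]_(1 + n)).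

Let WG := warped_metric h g0.
Let t := tcoord z.

Hypothesis hd : derivable h t 1.
Hypothesis ht0 : h t != 0.
Hypothesis g0d : differentiable g0 (rsubmx z).
Hypothesis g0sym : \forall w \near rsubmx z, (g0 w)^T = g0 w.
Hypothesis g0unit : g0 (rsubmx z) \in unitmx.

Let h' := 'D_1 h t.
(** The summand dt^2 of the metric; as an endomorphism, the projection onto the t-axis. *)
Let E0 : 'M[R]_(1 + n) := block_mx 1%:M 0 0 0.

Let h_derive v : is_derive z v (fun w => h (tcoord w)) (tcoord v * h').
Proof.
apply: (@is_derive_comp1 _ _ _ (@tcoord R n) h z v (tcoord v)).
- exact: tcoord_differentiable.
- have := @is_derive_linear _ _ _ lsubmx z v (@continuous_lsubmx _ _ _ _).
  by move=> /is_derive_mxP/(_ 0 0).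
- exact: hd.
Qed.

Let h2_derive v : is_derive z v (fun w => h (tcoord w) ^+ 2)
  (2 * h t * (tcoord v * h')).
Proof.
have := is_derive_mul (h_derive v) (h_derive v).
move=> /is_derive_eq; apply; rewrite -/t; ring.
Qed.

Let g0_rsubmx_d : differentiable (fun w : 'rV[R]_(1 + n) => g0 (rsubmx w)) z.
Proof.
apply: (@differentiable_comp _ _ _ _ rsubmx g0) => //.
exact: differentiable_rsubmx.
Qed.

Lemma warped_metric_differentiable : differentiable WG z.
Proof.
apply/differentiable_block/differentiable_scale => //.
have hdiff : differentiable (fun w => h (tcoord w)) z.
  apply: (@differentiable_comp _ _ _ _ (@tcoord R n) h).
    exact: tcoord_differentiable.
  exact/derivable1_diffP.
exact: (differentiableM hdiff hdiff).
Qed.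

Lemma warped_metric_sym : \forall w \near z, (WG w)^T = WG w.
Proof.
have := @continuous_rsubmx R 1 1 n z _ g0sym; rewrite !nbhs_simpl/= => S.
near=> w; rewrite /WG /warped_metric tr_block_mx !trmx0 trmx1 linearZ/=.
congr (block_mx _ _ _ (_ *: _)).
by near: w.
Unshelve. all: by end_near. Qed.

Lemma warped_metric_unitmx : WG z \in unitmx.
Proof.
rewrite unitmxE det_ublock det1 mul1r -unitmxE unitmxZ//.
by rewrite unitfE expf_neq0.
Qed.

Let e0 : 'I_(1 + n) := lshift n ord0.

Let evec_e0 : evec R e0 = row_mx 1%:M 0.
Proof.
apply/rowP => j; rewrite /evec mxE eqxx/=; case: (split_ordP j) => k ->.
  by rewrite row_mxEl mxE (inj_eq (@lshift_inj _ _)) eq_sym.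
by rewrite row_mxEr mxE eq_rlshift.
Qed.

Let fieldE w : conformal_field h w = h (tcoord w) *: evec R e0.
Proof.
by rewrite evec_e0 scale_row_mx scale_scalar_mx mulr1 scaler0.
Qed.

Let mulE0 v : v *m E0 = tcoord v *: evec R e0.
Proof.
rewrite -[in LHS](hsubmxK v) mul_row_block !mulmx0 !addr0 mulmx1 evec_e0.
by rewrite scale_row_mx scale_scalar_mx mulr1 scaler0 -mx11_scalar.
Qed.

Let field_derive v :
  is_derive z v (conformal_field h) ((tcoord v * h') *: evec R e0).
Proof.
have -> : conformal_field h = fun w => h (tcoord w) *: cst (evec R e0) w.
  by apply/funext => w; exact: fieldE.
have := is_derive_scale (h_derive v) (is_derive_cst (evec R e0) z v).
by rewrite scaler0 addr0.
Qed.

Let metric_derive v : is_derive z v WG (block_mx 0 0 0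
  ((2 * h t * (tcoord v * h')) *: g0 (rsubmx z) +
   h t ^+ 2 *: 'D_v (fun w : 'rV[R]_(1 + n) => g0 (rsubmx w)) z)).
Proof.
apply/is_derive_block/is_derive_scale; first exact: h2_derive.
exact/derivableP/diff_derivable/g0_rsubmx_d.
Qed.

Let e0_metric : evec R e0 *m WG z = evec R e0.
Proof. by rewrite evec_e0 mul_row_block !mulmx0 mul0mx !addr0 mulmx1. Qed.

(** Only the factor [h ^+ 2] of the lower block depends on t; multiplying by [h t] makes the right
    side a multiple of that block itself. *)
Let metric_derive_e0 :
  h t *: partial e0 WG z = (2 * h') *: (WG z - E0).
Proof.
have [_] := metric_derive (evec R e0); rewrite /partial => ->.
have -> : 'D_(evec R e0) (fun w : 'rV[R]_(1 + n) => g0 (rsubmx w)) z = 0.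
  rewrite -[X in 'D_(_) X z]/(g0 \o (rsubmx : 'rV[R]_(1 + n) -> 'rV[R]_n)).
  rewrite deriveE; last exact: g0_rsubmx_d.
  rewrite diff_comp//=; last exact: differentiable_rsubmx.
  rewrite (@diff_lin _ _ _ rsubmx); last exact: continuous_rsubmx.
  have E : rsubmx (evec R e0) = 0 by rewrite evec_e0 row_mxKr.
  by rewrite [X in 'd _ _ X]E linear0.
have -> : tcoord (evec R e0) = 1 by rewrite /tcoord evec_e0 row_mxKl mxE eqxx.
rewrite /WG /warped_metric /E0 opp_block_mx add_block_mx !scale_block_mx !subrr !scaler0 !addr0 oppr0.
congr (block_mx _ _ _ _).
  by rewrite addr0 !scalerA; congr (_ *: _); ring.
Qed.

(** The coordinate derivative of the field gives [h'] times row [p] of [E0], and the connection term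
    gives [h'] times row [p] of [1 - E0]. *)
Lemma warped_metric_conformal p :
  partial p (conformal_field h) z +
  conformal_field h z *m connection WG z (evec R p) = h' *: evec R p.
Proof.
have WGd k : derivable WG z (evec R k).
  exact/diff_derivable/warped_metric_differentiable.
have pX : partial p (conformal_field h) z = h' *: row p E0.
  by have [_] := field_derive (evec R p); rewrite rowE mulE0 scalerA mulrC.
pose dW k l s : R := partial k WG z l s.
have gam : \row_k christoffel WG z k p e0 =
    2^-1 *: (\row_l (dW p e0 l + dW e0 p l - dW l p e0)) *m invmx (WG z).
  by apply: christoffel_rowE => //; exact: warped_metric_sym.
(* Metric entries with an index [e0] are constant, so of the three Koszul terms only the
   t-derivative of the metric survives. *)
have dWe0 k l : dW k e0 l = 0.
  have [_] := metric_derive (evec R k); rewrite /dW /partial => ->.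
  by case: (split_ordP l) => j ->; rewrite ?block_mxEul ?block_mxEur mxE.
have dWe0' k l : dW k l e0 = 0.
  have [_] := metric_derive (evec R k); rewrite /dW /partial => ->.
  by case: (split_ordP l) => j ->; rewrite ?block_mxEul ?block_mxEdl mxE.
have dWp l : dW e0 p l = row p (partial e0 WG z) 0 l by rewrite mxE.
clearbody dW.
have ch : conformal_field h z *m connection WG z (evec R p) =
    h' *: (row p (WG z - E0) *m invmx (WG z)).
  rewrite fieldE -scalemxAl -rowE.
  have -> : row e0 (connection WG z (evec R p)) = \row_k christoffel WG z k p e0.
    by apply/rowP => k; rewrite [LHS]mxE [RHS]mxE connection_evec.
  rewrite gam.
  have -> : \row_l (dW p e0 l + dW e0 p l - dW l p e0) = row p (partial e0 WG z).
    by apply/rowP => l; rewrite mxE dWe0 dWe0' add0r subr0 dWp.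
  transitivity (2^-1 *: row p (h t *: partial e0 WG z) *m invmx (WG z)).
    by rewrite linearZ/= scalemxAl !scalerA mulrC.
  by rewrite metric_derive_e0 linearZ/= scalerA mulrA mulVf// mul1r scalemxAl.
have WE0 : E0 *m invmx (WG z) = E0.
  have E0W : E0 *m WG z = E0.
    by rewrite mulmx_block !mulmx0 !mul0mx !addr0 mulmx1.
  by rewrite -[in LHS]E0W mulmxK// warped_metric_unitmx.
rewrite pX ch -row_mul mulmxBl WE0 mulmxV ?warped_metric_unitmx//.
by rewrite -scalerDr -linearD/= addrC subrK row1.
Qed.

Lemma warped_divergence : divergence WG (conformal_field h) z = n.+1%:R * h'.
Proof.
rewrite divergenceE.
under eq_bigr => i _ do rewrite warped_metric_conformal !mxE !eqxx mulr1.
by rewrite sumr_const card_ord mulr_natl.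
Qed.

Lemma inner_conformal v : inner (WG z) (conformal_field h z) v = h t * tcoord v.
Proof.
rewrite /inner fieldE -!scalemxAl e0_metric mxE -rowE !mxE.
by congr (_ * _); rewrite /tcoord !mxE.
Qed.

Lemma conformal_field_differentiable : differentiable (conformal_field h) z.
Proof.
have -> : conformal_field h = fun w => h (tcoord w) *: evec R e0.
  by apply/funext => w; exact: fieldE.
apply: differentiableZl; apply: (@differentiable_comp _ _ _ _ (@tcoord R n) h).
  exact: tcoord_differentiable.
exact/derivable1_diffP.
Qed.

(** The chain rule and linearity of the connection in its direction carry conformality from the axes
    to the vectors F_i. *)
Lemma conformal_field_along m (F : 'rV[R]_m -> 'rV[R]_(1 + n)) y i :
  F y = z -> differentiable F y ->
  derivable (fun w => conformal_field h (F w)) y (evec R i) /\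
  partial i (fun w => conformal_field h (F w)) y +
    conformal_field h z *m connection WG z (partial i F y) = h' *: partial i F y.
Proof.
move=> Fy Fd.
have Xd : differentiable (conformal_field h) (F y).
  by rewrite Fy; exact: conformal_field_differentiable.
have Fi : is_derive y (evec R i) F (partial i F y).
  exact/derivableP/diff_derivable.
have [XFd XFE] := chain_rule Fd Xd Fi; split => //.
rewrite {1}/partial XFE Fy connection_sum mulmx_sumr -big_split/=.
rewrite [in RHS](row_sum_evec (partial i F y)) scaler_sumr.
apply: eq_bigr => k _.
by rewrite -scalemxAr -scalerDr warped_metric_conformal !scalerA mulrC.
Qed.

End WarpedMetric.

(** * Openness and nondegeneracy in charts *)

Section Charts.
Context {R : realType}.

(** On the open coordinate image [chart_param] is a continuous inverse, so every point near
    [chart_coord a x] is the coordinate of a point of [W]. This makes the domain of the local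
    representation of [psi] open. *)
Lemma open_chart_coord n (T : topologicalType) (a : rchart R n T) (W : set T) :
  is_rchart a -> open W -> open (chart_coord a @` (chart_dom a `&` W)).
Proof.
move=> [[oD oU pK] [_ pc] _ _ _] oW; rewrite openE => _ [x [Dx Wx] <-].
have Ux : (chart_coord a @` chart_dom a) (chart_coord a x) by exists x.
have pW : \forall w \near chart_coord a x, W (chart_param a w).
  by apply: (pc _ Ux); apply: open_nbhs_nbhs; split => //; rewrite pK.
near=> w.
have [x' Dx' x'w] : (chart_coord a @` chart_dom a) w.
  by near: w; exact: open_nbhs_nbhs.
exists x' => //; split => //.
by rewrite -(pK _ Dx') x'w; near: w.
Unshelve. all: by end_near. Qed.

Lemma chart_metric_unitmx n (T : topologicalType) (a : rchart R n T) y :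
  is_rchart a -> (chart_coord a @` chart_dom a) y -> chart_metric a y \in unitmx.
Proof.
by move=> [_ _ _ _ apos] Uy; apply: posdef_unitmx => v v0; exact: apos.
Qed.

End Charts.

Theorem proposition5p1 (R : realType) (m n : nat)
    (I : set R) (h : R -> R)
    (P : topologicalType) (AP : set (rchart R n P))
    (M : topologicalType) (AM : set (rchart R m M))
    (psi : M -> (R * P)%type) (t0 c : R) :
  open I -> is_interval I ->
  smooth1_on I h -> (forall t, I t -> 0 < h t) ->
  riemannian setT AP ->
  riemannian setT AM ->
  (forall x, I (psi x).1) ->
  let AMbar := warped_atlas I h AP in
  let X := fun _ : rchart R (1 + n) (R * P) => @conformal_field R n h in
  mcf_soliton AM AMbar X c psi ->
  c != 0 ->
  I t0 ->
  let eta := fun x : M => oriented_integral h t0 (psi x).1 in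
  forall (x : M) (a : rchart R m M) (b : rchart R (1 + n) (R * P)),
  AM a -> AMbar b -> chart_dom a x -> chart_dom b (psi x) ->
  let y := chart_coord a x in
  let z := chart_coord b (psi x) in
  let u := eta \o chart_param a in
  let phi := n.+1%:R^-1 * divergence (chart_metric b) (X b) z in
  let H := mean_curvature (chart_metric a) (chart_metric b) (local_rep a b psi) y in
  let normH2 := inner (chart_metric b z) H H in
  let normX2 := inner (chart_metric b z) (X b z) (X b z) in
  (laplacian (chart_metric a) u y = m%:R * phi + c^-1 * normH2 /\
   m%:R * phi + c^-1 * normH2 = m%:R * derive1 h (psi x).1 + c^-1 * normH2) /\
  (weighted_laplacian (chart_metric a) (fun w => - c * u w) u y
     = m%:R * phi + c * normX2 /\
   m%:R * phi + c * normX2 = m%:R * derive1 h (psi x).1 + c * h (psi x).1 ^+ 2).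
Proof.
move=> oI itvI hs hpos [_ APc _ _] [_ AMc _ _] psiI AMbar X [[psic iso] sol] c0 It0
  eta x a b Aa Ab ax bx y z u phi H normH2 normX2.
have [Vs _ Vpull] := iso a b Aa Ab.
have sol_xy := sol x a b Aa Ab ax bx.
(* A chart of the warped atlas comes from a chart [a0] of P, whose metric takes the place of
   [g0]. *)
move: (Ab) (bx) => [a0 /APc a0c ab0] bx'.
rewrite -ab0 in Ab bx bx' z phi H normH2 normX2 Vs Vpull sol_xy *.
move: (AMc _ Aa) => ac.
have [[oD0 oU0 _] _ g0s g0sym _] := a0c.
set g0 := chart_metric a0 in g0s g0sym.
set U0 := chart_coord a0 @` chart_dom a0 in oU0 g0s g0sym.
set V := _ @` _ in Vs Vpull.
set F := local_rep _ _ _ in Vs Vpull sol_xy H normH2 *.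
have [[_ _ pK] _ _ _ _] := ac.
have oV : open V.
  apply: open_chart_coord => //; apply: open_comp => [w _|]; first exact: psic.
  rewrite openE => -[t q] [It Dq]; exists (I, chart_dom a0) => //.
  by split; exact: open_nbhs_nbhs.
have Vy : V y by exists x.
have Fy : F y = z by rewrite /F /local_rep /= pK.
have hd t : I t -> derivable h t 1 by exact: (hs 0%N).
have tF w : tcoord (F w) = (psi (chart_param a w)).1.
  by rewrite /tcoord /F /local_rep /= row_mxKl mxE eqxx.
have tz : tcoord z = (psi x).1 by rewrite /tcoord /z /= row_mxKl mxE eqxx.
have U0z : U0 (rsubmx z).
  by rewrite /z /= row_mxKr; case: bx => _ ?; exists (psi x).2.
have hdz : derivable h (tcoord z) 1 by rewrite tz; exact: hd.
have hz0 : h (tcoord z) != 0 by rewrite tz gt_eqF// hpos.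
have g0d : differentiable g0 (rsubmx z) by exact: smooth_differentiable oU0 g0s U0z.
have g0S : \forall w \near rsubmx z, (g0 w)^T = g0 w.
  near=> w; apply: g0sym; near: w; exact: open_nbhs_nbhs.
have g0u : g0 (rsubmx z) \in unitmx by exact: chart_metric_unitmx.
have phiE : phi = derive1 h (psi x).1.
  rewrite /phi /X (warped_divergence hdz hz0 g0d g0S g0u) mulKf ?pnatr_eq0//.
  by rewrite derive1E tz.
have normX2E : normX2 = h (psi x).1 ^+ 2.
  rewrite /normX2 /X inner_conformal expr2 -tz; congr (_ * _).
  by rewrite /tcoord row_mxKl mxE eqxx.
have hc s : I s -> {for s, continuous h}.
  by move=> Is; apply/differentiable_continuous/derivable1_diffP/hd.
have uE : u = fun w => oriented_integral h t0 (tcoord (F w)).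
  by apply/funext => w; rewrite tF.
(* [u] depends on [w] only through [tcoord (F w)], so its partial derivatives are h dt(F_j), which
   [inner_conformal] reads as <X, F_j>. *)
have ud j w : V w -> is_derive w (evec R j) u (tcoord (partial j F w) * h (tcoord (F w))).
  move=> Vw; rewrite uE.
  have It : I (tcoord (F w)) by rewrite tF.
  have [OId OIE] := is_derive_oriented_integral oI itvI hc It0 It.
  have Fd : differentiable F w by exact: smooth_differentiable oV Vs Vw.
  have Fjd : is_derive w (evec R j) (fun w => tcoord (F w)) (tcoord (partial j F w)).
    have /is_derive_mxP/(_ 0 (lshift n 0)) := smooth_is_derive j Vs Vw.
    by rewrite /tcoord mxE; under [in X in _ -> X]eq_fun do rewrite mxE.
  rewrite -OIE; apply: is_derive_comp1 Fjd OId.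
  exact: (differentiable_comp Fd (@tcoord_differentiable _ _ _)).
have Xgrad j w : V w -> partial j u w =
    inner (warped_metric h g0 (F w)) (conformal_field h (F w)) (partial j F w).
  by move=> Vw; have [_ E] := ud j w Vw; rewrite inner_conformal mulrC -E.
have Fd : differentiable F y by exact: smooth_differentiable oV Vs Vy.
have along i := conformal_field_along hdz hz0 g0d g0S g0u i Fy Fd.
have Gu w : V w -> chart_metric a w \in unitmx.
  by move=> [x' [ax' _] <-]; apply: chart_metric_unitmx => //; exists x'.
have Gbd := warped_metric_differentiable hdz g0d.
have Gbs := warped_metric_sym h g0S.
have Gbu := warped_metric_unitmx hz0 g0u.
rewrite -Fy in along Gbd Gbs Gbu.
have Xd i := (along i).1; have Xc i := (along i).2.
split; (split; last by rewrite ?phiE ?normX2E).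
  have := laplacian_soliton oV Vy Vs Gu Vpull Gbd Gbs Gbu Xd Xc Xgrad sol_xy c0.
  by rewrite phiE Fy derive1E tz => ->.
have udy j : derivable u y (evec R j) by have [] := ud j y Vy.
have := weighted_laplacian_soliton oV Vy Vs Gu Vpull Gbd Gbs Gbu Xd Xc Xgrad sol_xy udy.
by rewrite phiE Fy derive1E tz => ->.
Unshelve. all: by end_near. Qed.
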